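(* The operator $$\Phi(r)=(D-C_r)(D+R_r)(D-C_r)^{-1}$$ is a hereditary recursion operator of the mirror non-Abelian Burgers equation $$r_t=G(r),\qquad G(r)=r_{xx}+2r_xr.$$ That is: (i) $\Phi(r)$ is a strong symmetry of $r_t=G(r)$: for every field $V$, $$\Phi'(r)[G(r)]\,V=G'(r)[\Phi(r)V]-\Phi(r)\,G'(r)[V];$$ (ii) $\Phi(r)$ is hereditary: for every $r$ at which $\Phi(r)$ is defined, the bilinear form $$(V,W)\longmapsto \Phi(r)\,\Phi'(r)[V]W-\Phi'(r)[\Phi(r)V]W$$ is symmetric in the fields $V,W$.
   Context: The unknown $r(x,t)$ is a smooth function of real variables $x,t$ with values in the bounded linear endomorphisms of a Banach space, so products are non-commutative. $D=\partial/\partial x$. For operator-valued functions $a,\sigma$: $L_a\sigma=a\sigma$, $R_a\sigma=\sigma a$, $C_a\sigma=[a,\sigma]=a\sigma-\sigma a$. Products of such linear operators denote composition. Fields $V,W$ (tangent vectors at $r$) are again operator-valued functions. The prime denotes the Fréchet (directional) derivative with respect to $r$: $G'(r)[V]=\frac{\partial}{\partial\epsilon}\big|_{\epsilon=0}G(r+\epsilon V)$, and $\Phi'(r)[V]=\frac{\partial}{\partial\epsilon}\big|_{\epsilon=0}\Phi(r+\epsilon V)$, which is a linear operator on fields for each $V$; $\Phi'(r)[V]W$ is its value on $W$. For the inverse one uses $\big((D-C_r)^{-1}\big)'[V]=(D-C_r)^{-1}C_V(D-C_r)^{-1}$. ''Recursion operator'' is used as a synonym of ''strong symmetry''. An operator-valued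 function $\Gamma(r)$ is a strong symmetry of $r_t=K(r)$ if it maps symmetries of this equation to symmetries; this is expressed by the condition $\Gamma'[K]V=K'[\Gamma V]-\Gamma K'[V]$ for all fields $V$. The setting is formal: no particular function space is fixed; $r$ and the fields belong to a space of operator-valued functions on which all the operations involved are defined and on which $D-C_r$ has the (two-sided) inverse $(D-C_r)^{-1}$. *)

(* Defs.v *)
From HB Require Import structures.
From mathcomp Require Import all_boot all_order all_algebra.
From mathcomp Require Import all_classical all_reals all_analysis.

Set Implicit Arguments.
Unset Strict Implicit.
Unset Printing Implicit Defensive.

Import Order.TTheory GRing.Theory Num.Theory.
Import numFieldNormedType.Exports.

Local Open Scope classical_set_scope.
Local Open Scope ring_scope.

(* The bounded linear endomorphisms of E, with the operator norm and with
   composition as product.  E is a real space: complex Banach spaces are covered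
   through their underlying real spaces. *)
Section BoundedEndomorphisms.
Variables (R : realType) (E : normedModType R).

Definition bounded_endo : {pred E -> E} := [pred f : E -> E |
  `[< linear f /\ exists M : R, forall x, `|f x| <= M * `|x| >]].

Lemma bounded_endoP (f : E -> E) :
  reflect (linear f /\ exists M : R, forall x, `|f x| <= M * `|x|)
          (f \in bounded_endo).
Proof. exact: asboolP. Qed.

Lemma bounded_endo_submod : submod_closed bounded_endo.
Proof.
split=> [|a f g /bounded_endoP[fl [M fM]] /bounded_endoP[gl [N gN]]].
  apply/bounded_endoP; split=> [a x y|].
    by rewrite -![(0 : E -> E) _]/(0 : E) scaler0 addr0.
  by exists 0 => x; rewrite -[(0 : E -> E) _]/(0 : E) normr0 mul0r.
apply/bounded_endoP; split=> [b x y|].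
  rewrite -![(a *: f + g) _]/(a *: f _ + g _).
  rewrite fl gl !scalerDr !scalerA mulrC -!addrA; congr (_ + _).
  by rewrite addrCA.
exists (`|a| * M + N) => x; rewrite -[(a *: f + g) x]/(a *: f x + g x).
rewrite (le_trans (ler_normD _ _))//.
by rewrite normrZ mulrDl lerD// -mulrA ler_wpM2l.
Qed.

HB.instance Definition _ :=
  GRing.isSubmodClosed.Build R (E -> E) bounded_endo bounded_endo_submod.

Record bop := Bop { bop_fun :> E -> E; _ : bop_fun \in bounded_endo }.

HB.instance Definition _ := [isSub for bop_fun].
HB.instance Definition _ := [Choice of bop by <:].
HB.instance Definition _ := [SubChoice_isSubLmodule of bop by <:].

Lemma bop_lin (f : bop) : linear f.
Proof. by have /bounded_endoP[] := valP f. Qed.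

Lemma bop_bnd (f : bop) : exists M : R, forall x, `|f x| <= M * `|x|.
Proof. by have /bounded_endoP[] := valP f. Qed.

Lemma bop0 (f : bop) : f 0 = 0.
Proof. by have := bop_lin f (-1) 0 0; rewrite !scaleN1r oppr0 add0r addNr. Qed.

Lemma bopD (f : bop) x y : f (x + y) = f x + f y.
Proof. by have := bop_lin f 1 x y; rewrite !scale1r. Qed.

Lemma bopZ (f : bop) a x : f (a *: x) = a *: f x.
Proof. by have := bop_lin f a x 0; rewrite bop0 !addr0. Qed.

Lemma bopP (f g : bop) : (forall x, f x = g x) -> f = g.
Proof. by move=> fg; apply: val_inj; apply/funext. Qed.

Definition bop_norm (f : bop) : R :=
  sup [set `|f x| | x in [set x : E | `|x| <= 1]].

Lemma has_sup_bop (f : bop) :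
  has_sup [set `|f x| | x in [set x : E | `|x| <= 1]].
Proof.
split; first by exists `|f 0|, 0 => //=; rewrite normr0.
have [M fM] := bop_bnd f; exists `|M| => _ [x /= x1 <-].
rewrite (le_trans (fM x))// (le_trans (ler_wpM2r _ (ler_norm M)))//.
by rewrite ler_piMr.
Qed.

Lemma bop_norm_le (f : bop) x : `|f x| <= bop_norm f * `|x|.
Proof.
have [->|x0] := eqVneq x 0; first by rewrite bop0 !normr0 mulr0.
have xgt0 : 0 < `|x| by rewrite normr_gt0.
rewrite -ler_pdivrMr//.
apply: sup_upper_bound; first exact: has_sup_bop.
exists (`|x|^-1 *: x) => /=.
  by rewrite normrZ ger0_norm ?invr_ge0// mulVf// gt_eqF.
by rewrite bopZ normrZ ger0_norm ?invr_ge0// mulrC.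
Qed.

Lemma bop_norm_lub (f : bop) M :
  (forall x, `|x| <= 1 -> `|f x| <= M) -> bop_norm f <= M.
Proof.
move=> fM; apply: ge_sup; first by have [] := has_sup_bop f.
by move=> _ [x /= x1 <-]; exact: fM.
Qed.

Lemma bop_norm_ge0 (f : bop) : 0 <= bop_norm f.
Proof.
apply: le_trans (normr_ge0 (f 0)) _; apply: sup_upper_bound.
  exact: has_sup_bop.
by exists 0 => //=; rewrite normr0.
Qed.

Lemma bop_norm_le1 (f : bop) x : `|x| <= 1 -> `|f x| <= bop_norm f.
Proof.
by move=> x1; rewrite (le_trans (bop_norm_le f x))// ler_piMr// bop_norm_ge0.
Qed.

Lemma bop_normD (f g : bop) : bop_norm (f + g) <= bop_norm f + bop_norm g.
Proof.
apply: bop_norm_lub => x x1; rewrite -[(f + g) x]/(f x + g x).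
by rewrite (le_trans (ler_normD _ _))// lerD// bop_norm_le1.
Qed.

Lemma bop_normZ (a : R) (f : bop) : bop_norm (a *: f) = `|a| * bop_norm f.
Proof.
have le b (g : bop) : bop_norm (b *: g) <= `|b| * bop_norm g.
  apply: bop_norm_lub => x x1; rewrite -[(b *: g) x]/(b *: g x).
  by rewrite normrZ ler_wpM2l// bop_norm_le1.
apply/le_anti; rewrite le/=; have [->|a0] := eqVneq a 0.
  by rewrite normr0 mul0r bop_norm_ge0.
rewrite -ler_pdivlMl ?normr_gt0// -[in leLHS](scalerK a0 f).
by rewrite (le_trans (le _ _))// normfV.
Qed.

Lemma bop_norm0_eq0 (f : bop) : bop_norm f = 0 -> f = 0.
Proof.
move=> f0; apply: bopP => x; apply/eqP; rewrite -normr_le0.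
by rewrite (le_trans (bop_norm_le f x))// f0 mul0r.
Qed.

HB.instance Definition _ := Lmodule_isNormed.Build R bop
  bop_normD bop_normZ bop_norm0_eq0.

Lemma bop_one_subproof : @idfun E \in bounded_endo.
Proof.
by apply/bounded_endoP; split=> [//|]; exists 1 => x; rewrite mul1r.
Qed.

Definition bop_one : bop := Bop bop_one_subproof.

Lemma bop_mul_subproof (f g : bop) : f \o g \in bounded_endo.
Proof.
apply/bounded_endoP; split=> [a x y /=|]; first by rewrite !bop_lin.
exists (bop_norm f * bop_norm g) => x /=.
rewrite (le_trans (bop_norm_le f _))// -mulrA ler_wpM2l ?bop_norm_ge0//.
exact: bop_norm_le.
Qed.

Definition bop_mul (f g : bop) : bop := Bop (bop_mul_subproof f g).

Fact bop_mulA : associative bop_mul.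
Proof. by move=> f g h; exact: bopP. Qed.

Fact bop_mul1 : left_id bop_one bop_mul.
Proof. by move=> f; exact: bopP. Qed.

Fact bop_mulr1 : right_id bop_one bop_mul.
Proof. by move=> f; exact: bopP. Qed.

Fact bop_mulDl : left_distributive bop_mul +%R.
Proof. by move=> f g h; exact: bopP. Qed.

Fact bop_mulDr : right_distributive bop_mul +%R.
Proof. by move=> f g h; apply: bopP => x; exact: bopD. Qed.

(* Not a nzRingType: E may be the zero space. *)
HB.instance Definition _ := GRing.Zmodule_isPzRing.Build bop
  bop_mulA bop_mul1 bop_mulr1 bop_mulDl bop_mulDr.

End BoundedEndomorphisms.

Arguments bop {R} E.

Section Fields.
Variables (R : realType) (E : completeNormedModType R).

(* Operator-valued functions of p = (x, t); their product is the pointwise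
   composition of operators. *)
Definition opfield := R * R -> bop E.

Definition Dx (u : opfield) : opfield := 'D_(1, 0) u.
Definition Dt (u : opfield) : opfield := 'D_(0, 1) u.

Fixpoint Cn (n : nat) (u : opfield) : Prop :=
  continuous u /\
  if n is m.+1 then
    [/\ forall p, derivable u p (1, 0), forall p, derivable u p (0, 1),
        Cn m (Dx u) & Cn m (Dt u)]
  else True.

Definition smooth (u : opfield) : Prop := forall n, Cn n u.

(* F is an unspecified space of smooth operator-valued functions, stable under
   the differential polynomial operations. *)
Record field_space (F : set opfield) : Prop := {
  field_space_smooth : forall u, F u -> smooth u;
  field_space0 : F 0;
  field_spaceD : forall u v, F u -> F v -> F (u + v);
  field_spaceZ : forall (a : R) u, F u -> F (a *: u);
  field_spaceM : forall u v, F u -> F v -> F (u * v);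
  field_spaceDx : forall u, F u -> F (Dx u) }.

Definition Rmul (a u : opfield) : opfield := u * a.
Definition Cad (a u : opfield) : opfield := a * u - u * a.

(* Derivative of G at r in the direction V, taken at each point (x, t) in the
   operator norm.  The library's 'D_v is total, with a default value where the
   limit does not exist; is_gderive also asserts existence. *)
Definition gderive (G : opfield -> opfield) (r V : opfield) : opfield :=
  fun p => 'D_1 (fun e : R => G (r + e *: V) p) 0.

Definition is_gderive (G : opfield -> opfield) (r V U : opfield) : Prop :=
  forall p, is_derive (0 : R) 1 (fun e : R => G (r + e *: V) p) (U p).

(* Gam'(r)[V] W *)
Definition op_gderive (Gam : opfield -> opfield -> opfield)
    (r V W : opfield) : opfield :=
  gderive (fun s => Gam s W) r V.

Definition DC (r : opfield) : opfield -> opfield := Dx \- Cad r.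

(* The inverse of D - C_r : F -> F; only meaningful on F, and when this map is
   a bijection. *)
Definition DCinv (F : set opfield) (r : opfield) : opfield -> opfield :=
  'pinv_(fun=> 0) F (DC r).

Definition Phi (F : set opfield) (r : opfield) : opfield -> opfield :=
  DC r \o (Dx \+ Rmul r) \o DCinv F r.

(* The points of F at which Phi and its directional derivatives are defined:
   D - C_s is invertible for s = r and for its perturbations s = r + e V with e
   small, and the inverse obeys the rule
   ((D - C_r)^-1)'[V] = (D - C_r)^-1 C_V (D - C_r)^-1. *)
Record Phi_dom (F : set opfield) (r : opfield) : Prop := {
  Phi_dom_mem : F r;
  Phi_dom_bij : forall V, F V ->
    \forall e \near (0 : R), set_bij F F (DC (r + e *: V));
  Phi_dom_inv : forall V W, F V -> F W ->
    is_gderive (fun s => DCinv F s W) r V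
      (DCinv F r (Cad V (DCinv F r W))) }.

Definition mirror_burgers (r : opfield) : opfield :=
  Dx (Dx r) + (Dx r * r) *+ 2.

(* Gam is a strong symmetry of r_t = K(r), at the points of dom. *)
Definition strong_symmetry (F dom : set opfield) (Gam : opfield -> opfield -> opfield)
    (K : opfield -> opfield) : Prop :=
  forall r, dom r -> forall V, F V ->
    op_gderive Gam r (K r) V = gderive K r (Gam r V) - Gam r (gderive K r V).

Definition hereditary_form (Gam : opfield -> opfield -> opfield)
    (r V W : opfield) : opfield :=
  Gam r (op_gderive Gam r V W) - op_gderive Gam r (Gam r V) W.

Definition hereditary (F dom : set opfield) (Gam : opfield -> opfield -> opfield) :
    Prop :=
  forall r, dom r -> forall V W, F V -> F W ->
    hereditary_form Gam r V W = hereditary_form Gam r W V.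

End Fields.

(* Main.v *)
Require Import Defs.
From mathcomp Require Import all_boot all_order all_algebra.
From mathcomp Require Import all_classical all_reals all_analysis.

Set Implicit Arguments.
Unset Strict Implicit.
Unset Printing Implicit Defensive.

Import Order.TTheory GRing.Theory Num.Theory.
Import numFieldNormedType.Exports.

Local Open Scope classical_set_scope.
Local Open Scope ring_scope.

(** Write [T] for the inverse of the covariant derivative [del := D - C_r],
    [lie x y] for the commutator [x y - y x], and [v := T V], [w := T W].

    Commuting the factors of [Phi r] past [T] leaves
      [Phi r V = V_x + V r + r_x (T V)]                       ([PhiE]),
    in which [T] is the only nonlocal ingredient and is never differentiated
    in [x].  As the same formula holds at all [r + e V] with [e] small, the
    pointwise rule for the derivative of [T] suffices to get
      [Phi'(r)[V] W = W V + V_x w + r_x T (lie V w)]          ([op_gderive_Phi]).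
    From there on the theorem is algebra in a noncommutative ring with a
    derivation [D].

    For hereditariness, the point is that [del] is itself a derivation, with
    [del r = r_x], and that everything is [del] of something up to a
    commutator: with [a := V + r v] and [b := W + r w],
      [Phi V = del a]   and
      [Phi'[V] W = del (V w + r T (lie V w)) - lie V b].
    Hence the bilinear form [Phi Phi'[V] W - Phi'[Phi V] W] is
    [del I + lie (del a) b] for an explicit [I = I(V, W)]
    ([hereditary_form_covd]).  The commutators obtained by exchanging [V] and
    [W] combine into [del (lie a b)], so that the form is symmetric as soon as
    [I(W, V) = I(V, W) + lie a b].  The terms under [T] are removed by applying
    [T] to the Leibniz rule for [lie u u'] ([covd_inv_lie]), and what remains
    is a polynomial identity ([recursion_hereditary]).

    The strong symmetry property follows from hereditariness.  Because
    [T r_x = r], the Burgers flow is [G r = Phi r r_x] ([burgers_flowE]): it is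
    the image of the flow [r_x] of the translations in [x], with which [Phi]
    commutes, i.e. [Phi'[r_x] = [D, Phi]] ([recursion_translation]).  The
    symmetry of the form at the pair [(r_x, V)] turns this into the condition
    for [G] ([recursion_strong_symmetry]). *)

(** * Identities in noncommutative rings *)

(** The four lemmas below drive [nc_ring].  A sum to be shown zero is kept in the
    form [x + s + t]: [x] is the term being cancelled, [s] the terms in which
    its opposite is still to be looked for, [t] those already passed. *)
Lemma sum_keep (V : zmodType) (x s y t : V) :
  x + s + (y + t) = 0 -> x + (y + s) + t = 0.
Proof. by rewrite (addrA _ y) (addrC y) -!addrA [s + (y + t)]addrCA. Qed.

Lemma sum_cancel (V : zmodType) (x s t : V) :
  s + t = 0 -> x + (- x + s) + t = 0.
Proof. by rewrite addrA subrr add0r. Qed.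

Lemma sum_cancelN (V : zmodType) (x s t : V) :
  s + t = 0 -> - x + (x + s) + t = 0.
Proof. by rewrite addrA addNr add0r. Qed.

Lemma sum_start (V : zmodType) (x y : V) : (x - y) + 0 + 0 = 0 -> x = y.
Proof. by rewrite !addr0; exact: subr0_eq. Qed.

Ltac nc_cancel :=
  rewrite -?addrA ?add0r;
  lazymatch goal with
  | |- 0 = 0 => reflexivity
  | |- ?x + ?s = 0 => rewrite -[x + s]addr0; nc_find
  end
with nc_find :=
  lazymatch goal with
  | |- ?x + (- ?x + _) + _ = 0 => apply: sum_cancel; nc_cancel
  | |- - ?x + (?x + _) + _ = 0 => apply: sum_cancelN; nc_cancel
  | |- _ + (_ + _) + _ = 0 => apply: sum_keep; nc_find
  end.
(* Decides equality of noncommutative polynomials, with integer coefficients given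
   by repetition: after expansion every monomial must meet its opposite. *)
Ltac nc_ring :=
  apply: sum_start;
  rewrite ?(mulrDl, mulrDr, mulNr, mulrN, opprD, opprK, mulrA); nc_cancel.

(** * Calculus of operator-valued functions *)

Section BoundedOperators.
Variables (R : realType) (E : normedModType R).
Implicit Types f g : bop E.

Lemma bop_normM f g : `|f * g| <= `|f| * `|g|.
Proof.
apply: bop_norm_lub => x x1.
rewrite (le_trans (bop_norm_le f _))// ler_wpM2l ?bop_norm_ge0//.
exact: bop_norm_le1.
Qed.

Lemma bop_scalerAl (a : R) f g : a *: (f * g) = (a *: f) * g.
Proof. exact: bopP. Qed.

Lemma bop_scalerAr (a : R) f g : a *: (f * g) = f * (a *: g).
Proof. by apply: bopP => x; rewrite -[RHS]/(f (a *: g x)) bopZ. Qed.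

Lemma cvg_bopM (T : Type) (G : set_system T) {FG : Filter G}
    (u v : T -> bop E) (a b : bop E) :
  u @ G --> a -> v @ G --> b -> (fun x => u x * v x) @ G --> a * b.
Proof.
move=> ua vb; apply/subr_cvg0; apply: norm_cvg0.
have un : (fun x => `|u x - a|) @ G --> (0 : R).
  rewrite -(@normr0 _ (bop E)); apply: cvg_norm; exact/subr_cvg0.
have vn : (fun x => `|v x - b|) @ G --> (0 : R).
  rewrite -(@normr0 _ (bop E)); apply: cvg_norm; exact/subr_cvg0.
have nv : (fun x => `|v x|) @ G --> `|b| by exact: cvg_norm.
pose h x := `|u x - a| * `|v x| + `|a| * `|v x - b|.
have h0 : h @ G --> (0 : R).
  rewrite -(addr0 0) -{1}(mul0r `|b|) -{2}(mulr0 `|a|).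
  by apply: cvgD; apply: cvgM => //; exact: cvg_cst.
apply: (squeeze_cvgr _ (cvg_cst 0) h0).
apply: nearW => x; rewrite normr_ge0/= /h.
have -> : u x * v x - a * b = (u x - a) * v x + a * (v x - b).
  by rewrite mulrBl mulrBr addrA subrK.
by rewrite (le_trans (ler_normD _ _))// lerD// bop_normM.
Qed.

(** A function differentiable in the direction [v] need not be continuous, but
    its restriction to the line through [x] along [v] is continuous at [x],
    which is all that the product rule asks. *)
Lemma is_derive_bopM (V : normedModType R) (x v : V) (f g : V -> bop E)
    (df dg : bop E) :
  is_derive x v f df -> is_derive x v g dg ->
  is_derive x v (f * g) (df * g x + f x * dg).
Proof.
move=> [cf ef] [cg eg].
pose q (u : V -> bop E) h := h^-1 *: ((u \o shift x) (h *: v) - u x).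
have {cf ef} qf : q f h @[h --> (0 : R)^'] --> df by rewrite -ef.
have {cg eg} qg : q g h @[h --> (0 : R)^'] --> dg by rewrite -eg.
have g_cvg : g (h *: v + x) @[h --> (0 : R)^'] --> g x.
  apply/subr_cvg0; rewrite -(scale0r dg).
  have : h *: q g h @[h --> (0 : R)^'] --> 0 *: dg.
    by apply: cvgZ => //; apply: cvg_within.
  apply: cvg_trans; apply: near_eq_cvg; near=> h.
  rewrite /q scalerA mulfV ?scale1r//.
  by near: h; exact: nbhs_dnbhs_neq.
have q_cvg : q (f * g) h @[h --> (0 : R)^'] --> df * g x + f x * dg.
  rewrite (_ : q (f * g) = fun h => q f h * g (h *: v + x) + f x * q g h).
    by apply: cvgD; apply: cvg_bopM => //; exact: cvg_cst.
  apply/funext => h; rewrite /q -bop_scalerAl -bop_scalerAr -scalerDr /=.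
  by congr (_ *: _); rewrite mulrBl mulrBr addrA subrK.
apply: DeriveDef; first by apply/cvg_ex; exists (df * g x + f x * dg).
exact: cvg_lim q_cvg.
Unshelve. all: by end_near. Qed.

End BoundedOperators.

(** * The algebra of the recursion operator *)

(** The Leibniz rule is relative to [F] because the ambient ring consists of all
    operator-valued functions, differentiable or not, with a derivative that
    takes default values. *)
Record derivation_on (A : pzRingType) (F : set A) (d : A -> A) : Prop := {
  derivation_onD : forall u v, F u -> F v -> F (u + v);
  derivation_onN : forall u, F u -> F (- u);
  derivation_onM : forall u v, F u -> F v -> F (u * v);
  derivation_on_stable : forall u, F u -> F (d u);
  derivation_on_additive : forall u v, F u -> F v -> d (u + v) = d u + d v;
  derivation_on_leibniz :
    forall u v, F u -> F v -> d (u * v) = d u * v + u * d v }.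

Definition inverse_on (A : Type) (F : set A) (f g : A -> A) :=
  [/\ forall u, F u -> F (g u), forall u, F u -> g (f u) = u
    & forall u, F u -> f (g u) = u].

Section Derivation.
Variables (A : pzRingType) (F : set A) (d T : A -> A) (r : A).
Local Notation lie x y := (x * y - y * x).

(** The covariant derivative [D - C_r]. *)
Definition covd u := d u - lie r u.

(** The factorised operator [Phi r] with its [D T] and [D D T] terms cancelled. *)
Definition recursion V := d V + V * r + d r * T V.

(** [Phi'(r)[V] W], the derivative of [T] being [T C_V T]. *)
Definition drecursion V W := W * V + d V * T W + d r * T (lie V (T W)).

Definition burgers_flow := d (d r) + (d r * r) *+ 2.
Definition burgers_dflow V := d (d V) + (d V * r + d r * V) *+ 2.

Local Notation del := covd.
Local Notation phi := recursion.
Local Notation dphi := drecursion.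

Hypotheses (der_d : derivation_on F d) (Fr : F r) (invT : inverse_on F del T).

Let FD := derivation_onD der_d.
Let FN := derivation_onN der_d.
Let FM := derivation_onM der_d.
Let Fd := derivation_on_stable der_d.
Let dD := derivation_on_additive der_d.
Let dM := derivation_on_leibniz der_d.
Let FT : forall u, F u -> F (T u). Proof. by case: invT. Qed.
Let delK : forall u, F u -> T (del u) = u. Proof. by case: invT. Qed.
Let TK : forall u, F u -> del (T u) = u. Proof. by case: invT. Qed.

Let FB u v : F u -> F v -> F (u - v).
Proof. by move=> Fu Fv; apply: FD => //; apply: FN. Qed.

Let Flie u v : F u -> F v -> F (lie u v).
Proof. by move=> Fu Fv; apply: FB; apply: FM. Qed.

Let Fdel u : F u -> F (del u).
Proof. by move=> Fu; apply: FB; [apply: Fd|apply: Flie]. Qed.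

Ltac inF := repeat first [assumption | apply: FB | apply: FD | apply: FM
  | apply: Fd | apply: FT | apply: Fdel].

Lemma recursion_closed V : F V -> F (phi V).
Proof. by move=> FV; inF. Qed.

Lemma drecursion_closed V W : F V -> F W -> F (dphi V W).
Proof. by move=> FV FW; inF. Qed.

Lemma burgers_flow_closed : F burgers_flow.
Proof. by rewrite /burgers_flow mulr2n; inF. Qed.

Lemma burgers_dflow_closed V : F V -> F (burgers_dflow V).
Proof. by move=> FV; rewrite /burgers_dflow mulr2n; inF. Qed.

Lemma covdD u v : F u -> F v -> del (u + v) = del u + del v.
Proof. by move=> Fu Fv; rewrite /covd dD//; nc_ring. Qed.

Lemma covdB u v : F u -> F v -> del (u - v) = del u - del v.
Proof.
move=> Fu Fv; apply/eqP; rewrite -(addrK (del v) (del (u - v))) -covdD//.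
  by rewrite subrK.
by inF.
Qed.

Let dB u v : F u -> F v -> d (u - v) = d u - d v.
Proof.
move=> Fu Fv; apply/eqP; rewrite -(addrK (d v) (d (u - v))) -dD//.
  by rewrite subrK.
by inF.
Qed.

Lemma covdM u v : F u -> F v -> del (u * v) = del u * v + u * del v.
Proof. by move=> Fu Fv; rewrite /covd dM//; nc_ring. Qed.

Lemma covd_lie u v : F u -> F v ->
  del (lie u v) = lie (del u) v + lie u (del v).
Proof. by move=> Fu Fv; rewrite covdB ?covdM//; [nc_ring|inF|inF]. Qed.

Lemma covd_r : del r = d r.
Proof. by rewrite /covd subrr subr0. Qed.

Lemma covd_inj u v : F u -> F v -> del u = del v -> u = v.
Proof. by move=> Fu Fv duv; rewrite -(delK Fu) duv delK. Qed.

Lemma covd_invD u v : F u -> F v -> T (u + v) = T u + T v.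
Proof.
by move=> Fu Fv; apply: covd_inj; [inF|inF|rewrite covdD ?TK//; inF].
Qed.

Lemma covd_invB u v : F u -> F v -> T (u - v) = T u - T v.
Proof.
by move=> Fu Fv; apply: covd_inj; [inF|inF|rewrite covdB ?TK//; inF].
Qed.

(** Integration by parts: [T] applied to
    [del (lie u v) = lie (del u) v + lie u (del v)]. *)
Lemma covd_inv_lie u v : F u -> F v ->
  T (lie (del u) v) = lie u v + T (lie (del v) u).
Proof.
move=> Fu Fv; apply/eqP; rewrite -subr_eq -covd_invB; [|inF|inF].
by rewrite opprB -covd_lie// delK//; inF.
Qed.

Lemma recursionD u v : F u -> F v -> phi (u + v) = phi u + phi v.
Proof. by move=> Fu Fv; rewrite /recursion covd_invD// dD//; nc_ring. Qed.

Lemma recursionB u v : F u -> F v -> phi (u - v) = phi u - phi v.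
Proof. by move=> Fu Fv; rewrite /recursion covd_invB// dB//; nc_ring. Qed.

Lemma recursion_covd V : F V -> phi V = del (V + r * T V).
Proof.
move=> FV; rewrite covdD ?covdM ?TK ?covd_r//; [|inF..].
by rewrite /covd /recursion; nc_ring.
Qed.

(** This is the derivative of the product [(D - C_r) (D + R_r) T] factor by factor;
    unlike the definition of [drecursion] it isolates what [T] cancels. *)
Lemma drecursion_covd V W : F V -> F W ->
  dphi V W = del (V * T W + r * T (lie V (T W))) - lie V (W + r * T W).
Proof.
move=> FV FW; rewrite covdD ?covdM ?TK ?covd_r//; [|inF..].
by rewrite /drecursion /covd; nc_ring.
Qed.

(** Both summands are [del] of something up to [lie _ b].  In the first one,
    [phi N = del (N + r T N)] with [N := dphi V W], and [drecursion_covd] gives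
    [T N]; the second one is [drecursion_covd] at [phi V = del a]. *)
Lemma hereditary_form_covd V W (a := V + r * T V) (b := W + r * T W) :
  F V -> F W ->
  phi (dphi V W) - dphi (phi V) W =
  del (dphi V W + r * (V * T W + r * T (lie V (T W)))
       - r * (T (lie V b) + T (lie (del a) (T W))) - phi V * T W)
  + lie (del a) b.
Proof.
move=> FV FW.
have Fa : F a by inF.
have Fb : F b by inF.
have TN : T (dphi V W) = V * T W + r * T (lie V (T W)) - T (lie V b).
  by rewrite drecursion_covd// covd_invB ?delK//; inF.
rewrite recursion_covd; last exact: drecursion_closed.
rewrite (drecursion_covd (recursion_closed FV) FW) TN.
rewrite (recursion_covd FV) -/a -/b.
rewrite opprB addrCA addrC -covdB; [|inF..].
by congr (del _ + _); nc_ring.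
Qed.

(** [lie (del a) b + lie a (del b) = del (lie a b)], so it suffices to compare the
    arguments of [del].  Integration by parts replaces the three terms under [T]
    that involve [V] on the left by those that involve [W] there; these then
    cancel. *)
Theorem recursion_hereditary V W : F V -> F W ->
  phi (dphi V W) - dphi (phi V) W = phi (dphi W V) - dphi (phi W) V.
Proof.
move=> FV FW; rewrite !hereditary_form_covd//.
set v := T V; set w := T W; set a := V + r * v; set b := W + r * w.
have Fv : F v by inF.
have Fw : F w by inF.
have Fa : F a by inF.
have Fb : F b by inF.
have FdJ : F (dphi V W) by apply: drecursion_closed.
have FpV : F (phi V) by apply: recursion_closed.
have dvE : del v = V by rewrite TK.
have dwE : del w = W by rewrite TK.
have Vw : T (lie V w) = lie v w + T (lie W v).
  by rewrite -dvE -dwE covd_inv_lie.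
have Vb : T (lie V b) = lie v b + T (lie (del b) v).
  by rewrite -dvE covd_inv_lie.
have aw : T (lie (del a) w) = lie a w + T (lie W a).
  by rewrite covd_inv_lie// dwE.
set J := (J in _ = del J + _); set I := (I in del I + _ = _).
have FI : F I by inF.
have -> : J = I + lie a b.
  rewrite /J /I /recursion /drecursion -/v -/w Vb aw Vw.
  move: (T (lie W v)) (T (lie (del b) v)) (T (lie W a)) => x y z.
  by rewrite /a /b; nc_ring.
(* [nc_ring] must see [I], [a], [b] and their [del] as indeterminates. *)
clearbody I a b.
rewrite covdD ?covd_lie//; last by inF.
by move: (del I) (del a) (del b) => *; nc_ring.
Qed.

Lemma covd_inv_dr : T (d r) = r.
Proof. by rewrite -covd_r delK. Qed.

(** The nonlocal term of [phi (d r)] is local after all, because [d r = del r]. *)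
Lemma burgers_flowE : phi (d r) = burgers_flow.
Proof. by rewrite /recursion /burgers_flow covd_inv_dr mulr2n addrA. Qed.

(** The derivative of [burgers_flowE] along [V], the derivative of [d r] being
    [d V]. *)
Lemma burgers_dflowE V : F V -> burgers_dflow V = dphi V (d r) + phi (d V).
Proof.
move=> FV; have FdV : F (d V) by inF.
have TV : T (d V) = V - T (lie V r).
  rewrite -{2}(delK FV) -covd_invB; [|inF..].
  by congr T; rewrite /covd; nc_ring.
rewrite /burgers_dflow /drecursion /recursion covd_inv_dr TV mulr2n.
by nc_ring.
Qed.

(** [Phi] has no explicit dependence on [x], so its derivative along [r_x] is its
    commutator with [D].  The nonlocal term rests on
    [del (D w) = D (del w) + lie r_x w]. *)
Lemma recursion_translation V :
  F V -> dphi (d r) V = d (phi V) - phi (d V).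
Proof.
move=> FV.
have dT : d (T V) = T (d V) + T (lie (d r) (T V)).
  apply: covd_inj; [inF|inF|].
  rewrite covdD ?TK; [|inF..].
  have {2}-> : V = d (T V) - lie r (T V) by rewrite -{1}(TK FV).
  rewrite !(dB, dM); [|inF..].
  by rewrite /covd; nc_ring.
rewrite /recursion !dD ?dM ?dT; [|inF..].
by rewrite /drecursion; nc_ring.
Qed.

(** With [K = phi (d r)], the right-hand side is
    [dphi (phi V) (d r) - phi (dphi V (d r)) + phi ([D, phi] V)].  The bracket is
    [dphi (d r) V] by translation invariance, and [recursion_hereditary] at
    [(d r, V)] turns the sum into [dphi K V]. *)
Theorem recursion_strong_symmetry V : F V ->
  dphi burgers_flow V = burgers_dflow (phi V) - phi (burgers_dflow V).
Proof.
move=> FV.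
have FdV : F (d V) by inF.
have FpV : F (phi V) by apply: recursion_closed.
have Fdr : F (d r) by inF.
rewrite !burgers_dflowE// recursionD;
  [|exact: drecursion_closed|exact: recursion_closed].
have := recursion_hereditary Fdr FV.
rewrite recursion_translation// burgers_flowE.
rewrite recursionB; [|inF..].
(* From here on the identity is linear in these five fields. *)
move: (phi (phi (d V))) (phi (d (phi V))) (phi (dphi V (d r)))
  (dphi (phi V) (d r)) (dphi burgers_flow V) => x1 x2 x3 x4 x5 h.
have -> : x5 = x2 - x1 - (x2 - x1 - x5) by nc_ring.
by rewrite h; nc_ring.
Qed.

End Derivation.

(** * Directional derivatives of the recursion operator *)

Section Fields.
Variables (R : realType) (E : completeNormedModType R).
Implicit Types u v : opfield E.

Lemma is_derive_Dx u (p : R * R) :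
  smooth u -> is_derive p ((1, 0) : R * R) u (Dx u p).
Proof. by move=> /(_ 1%N)[_ [du _ _ _]]; exact: derivableP. Qed.

Lemma DxD u v : smooth u -> smooth v -> Dx (u + v) = Dx u + Dx v.
Proof.
move=> su sv; apply/funext => p.
by have [_] := is_deriveD (is_derive_Dx p su) (is_derive_Dx p sv).
Qed.

Lemma DxZ (a : R) u : smooth u -> Dx (a *: u) = a *: Dx u.
Proof.
by move=> su; apply/funext => p; have [_] := is_deriveZ a (is_derive_Dx p su).
Qed.

Lemma DxM u v : smooth u -> smooth v -> Dx (u * v) = Dx u * v + u * Dx v.
Proof.
move=> su sv; apply/funext => p.
by have [_] := is_derive_bopM (is_derive_Dx p su) (is_derive_Dx p sv).
Qed.

Lemma is_gderive_gderive G r V (U : opfield E) :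
  is_gderive G r V U -> gderive G r V = U.
Proof. by move=> dG; apply/funext => p; have [] := dG p. Qed.

Lemma is_gderive_near G H r V (U : opfield E) :
  (\forall e \near (0 : R), G (r + e *: V) = H (r + e *: V)) ->
  is_gderive H r V U -> is_gderive G r V U.
Proof.
move=> GH dH p; apply: near_eq_is_derive (dH p).
by apply: filterS GH => e ->.
Qed.

Lemma is_gderive_cst (u r V : opfield E) : is_gderive (fun=> u) r V 0.
Proof. by move=> p; exact: is_derive_cst. Qed.

Lemma is_gderiveD G H r V (U W : opfield E) :
  is_gderive G r V U -> is_gderive H r V W ->
  is_gderive (fun s => G s + H s) r V (U + W).
Proof. by move=> dG dH p; exact: is_deriveD (dG p) (dH p). Qed.

Lemma is_gderiveM G H r V (U W : opfield E) :
  is_gderive G r V U -> is_gderive H r V W ->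
  is_gderive (fun s => G s * H s) r V (U * H r + G r * W).
Proof.
move=> dG dH p; have := is_derive_bopM (dG p) (dH p).
by rewrite scale0r addr0.
Qed.

Lemma is_gderive_id (r V : opfield E) : is_gderive id r V V.
Proof.
move=> p; rewrite -[V p in X in is_derive _ _ _ X]add0r.
apply: (is_deriveD (is_derive_cst (r p) (0 : R) 1)).
have q_cvg : h^-1 *: ((h *: (1 : R) + 0) *: V p - 0 *: V p)
    @[h --> (0 : R)^'] --> V p.
  apply: cvg_near_cst; near=> h.
  rewrite scale0r subr0 addr0 scalerA -[h *: 1]/(h * 1) mulr1 mulVf ?scale1r//.
  by near: h; exact: nbhs_dnbhs_neq.
apply: DeriveDef; first by apply/cvg_ex; exists (V p).
exact: cvg_lim q_cvg.
Unshelve. all: by end_near. Qed.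

Lemma is_gderive_affine G r V (U : opfield E) :
  (forall e : R, G (r + e *: V) = G r + e *: U) -> is_gderive G r V U.
Proof.
move=> GU p; rewrite (_ : (fun e => _) = fun e : R => (G r + e *: U) p).
  exact: is_gderive_id.
by apply/funext => e; rewrite GU.
Qed.

Section FieldSpace.
Variables (F : set (opfield E)) (hF : field_space F).

Let FD u v : F u -> F v -> F (u + v). Proof. exact: field_spaceD. Qed.
Let FZ (a : R) u : F u -> F (a *: u). Proof. exact: field_spaceZ. Qed.
Let FM u v : F u -> F v -> F (u * v). Proof. exact: field_spaceM. Qed.
Let FDx u : F u -> F (Dx u). Proof. exact: field_spaceDx. Qed.
Let FN u : F u -> F (- u). Proof. by rewrite -scaleN1r; exact: FZ. Qed.
Let Fsmooth u : F u -> smooth u. Proof. exact: field_space_smooth. Qed.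

Lemma derivation_on_Dx : derivation_on F (@Dx R E).
Proof.
by split=> // u v /Fsmooth su /Fsmooth sv; [exact: DxD|exact: DxM].
Qed.

Lemma inverse_on_DCinv s :
  set_bij F F (DC s) -> inverse_on F (DC s) (DCinv F s).
Proof.
move=> [DCF DC_inj DC_surj]; split=> u Fu.
- have [v Fv <-] := DC_surj u Fu.
  by rewrite /DCinv pinvKV ?inE.
- by rewrite /DCinv pinvKV ?inE.
- by have := surjpK (fun=> 0) DC_surj; apply; rewrite inE.
Qed.

Let Dx_line u v (e : R) : F u -> F v -> Dx (u + e *: v) = Dx u + e *: Dx v.
Proof.
by move=> Fu Fv; rewrite DxD ?DxZ//; apply: Fsmooth => //; exact: FZ.
Qed.

(** On the image [w] of [DCinv], [Dx w + w s = W + s w]; applying [D - C_s] to it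
    meets [w] only through [W = (D - C_s) w]. *)
Lemma PhiE s W : F s -> set_bij F F (DC s) -> F W ->
  Phi F s W = recursion (@Dx R E) (DCinv F s) s W.
Proof.
move=> Fs bs FW; have inv_s := inverse_on_DCinv bs.
rewrite (recursion_covd derivation_on_Dx Fs inv_s FW).
have [FT _ DCK] := inv_s.
rewrite /Phi /=; set w := DCinv F s W.
have -> : W + s * w = DC s w + s * w by rewrite DCK.
by congr DC; rewrite /DC /Rmul /Cad /=; nc_ring.
Qed.

Section AtPoint.
Variable r : opfield E.
Hypothesis r_dom : Phi_dom F r.
Let Fr : F r. Proof. exact: Phi_dom_mem r_dom. Qed.

Lemma near_bij V :
  F V -> \forall e \near (0 : R), set_bij F F (DC (r + e *: V)).
Proof. exact: Phi_dom_bij r_dom V. Qed.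

Lemma bij_r : set_bij F F (DC r).
Proof.
by have := nbhs_singleton (near_bij Fr); rewrite scale0r addr0.
Qed.

(** The factorised operator cannot be differentiated directly, since nothing is
    known about the [x]-derivatives of [e |-> DCinv F (r + e *: V) W]; its local
    form near [r] contains this function undifferentiated. *)
Lemma op_gderive_Phi V W : F V -> F W ->
  op_gderive (Phi F) r V W = drecursion (@Dx R E) (DCinv F r) r V W.
Proof.
move=> FV FW; apply: is_gderive_gderive.
(* The local form of [Phi F s W]. *)
pose H s := Dx W + W * s + Dx s * DCinv F s W.
apply: (@is_gderive_near _ H).
  near=> e; apply: PhiE => //; first by apply: FD => //; apply: FZ.
  by near: e; exact: near_bij.
have dT := Phi_dom_inv r_dom FV FW.
have dH := is_gderiveD (is_gderiveD (is_gderive_cst (Dx W) r V)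
  (is_gderiveM (is_gderive_cst W r V) (is_gderive_id r V)))
   (is_gderiveM (is_gderive_affine (fun e => Dx_line e Fr FV)) dT).
by move: dH; rewrite add0r mul0r add0r addrA.
Unshelve. all: by end_near. Qed.

Lemma gderive_burgers V : F V ->
  gderive (@mirror_burgers R E) r V = burgers_dflow (@Dx R E) r V.
Proof.
move=> FV; apply: is_gderive_gderive.
have dD := is_gderive_affine (fun e => Dx_line e Fr FV).
have dDD : is_gderive (fun s : opfield E => Dx (Dx s)) r V (Dx (Dx V)).
  by apply: is_gderive_affine => e; rewrite !Dx_line//; exact: FDx.
have dM := is_gderiveM dD (is_gderive_id r V).
exact: is_gderiveD dDD (is_gderiveD dM dM).
Qed.

Let PhiEr W : F W -> Phi F r W = recursion (@Dx R E) (DCinv F r) r W.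
Proof. by apply: PhiE => //; exact: bij_r. Qed.

Lemma Phi_strong_symmetry_at V : F V ->
  op_gderive (Phi F) r (mirror_burgers r) V =
  gderive (@mirror_burgers R E) r (Phi F r V)
  - Phi F r (gderive (@mirror_burgers R E) r V).
Proof.
move=> FV; have inv_r := inverse_on_DCinv bij_r.
have FK := burgers_flow_closed derivation_on_Dx Fr.
have FKV := burgers_dflow_closed derivation_on_Dx Fr FV.
have FPhi := recursion_closed derivation_on_Dx Fr inv_r FV.
rewrite op_gderive_Phi// PhiEr// !gderive_burgers// PhiEr//.
exact: recursion_strong_symmetry derivation_on_Dx Fr inv_r V FV.
Qed.

Lemma Phi_hereditary_at V W : F V -> F W ->
  hereditary_form (Phi F) r V W = hereditary_form (Phi F) r W V.
Proof.
move=> FV FW; have inv_r := inverse_on_DCinv bij_r.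
have Frec := recursion_closed derivation_on_Dx Fr inv_r.
have Fdrec := drecursion_closed derivation_on_Dx Fr inv_r.
have [FPV FPW] := (Frec V FV, Frec W FW).
have [FVW FWV] := (Fdrec V W FV FW, Fdrec W V FW FV).
rewrite /hereditary_form (PhiEr FV) (PhiEr FW) !op_gderive_Phi// !PhiEr//.
exact: recursion_hereditary derivation_on_Dx Fr inv_r V W FV FW.
Qed.

End AtPoint.
End FieldSpace.
End Fields.

Theorem theorem2 (R : realType) (E : completeNormedModType R)
    (F : set (opfield E)) (hF : field_space F) :
  strong_symmetry F (Phi_dom F) (Phi F) (@mirror_burgers R E) /\
  hereditary F (Phi_dom F) (Phi F).
Proof.
split=> [r r_dom V FV|r r_dom V W FV FW].
- exact: Phi_strong_symmetry_at.
- exact: Phi_hereditary_at.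
Qed.
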